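(* For every $d\ge 1$, the numbers $S^{(d)}_n$ of $d$-admissible chord diagrams in an $(n+3)$-gon are determined by the generating function $S^{(d)}(x)=\sum_{n=0}^\infty S^{(d)}_n x^n$, where $$S^{(d)}(x)=\frac{1}{1-2x-\sum_{k=1}^{d-1}C_k x^{k+1}}.$$
   Context: $C_k=\frac{1}{k+1}\binom{2k}{k}$ is the $k$-th Catalan number. Consider a convex $(n+3)$-gon with vertices $1,\dots,n+3$ in cyclic order; a chord $\overline{ab}$ joins two non-adjacent vertices. For $d\ge 1$, the set $\mathcal Ch_d$ of $d$-chords consists of: $\overline{1i}$ for $3\le i\le n+2$; $\overline{j(n+3)}$ for $2\le j\le n+1$; and $\overline{ij}$ for $2\le i<j\le n+2$ with $2\le j-i\le d$. Two $d$-chords are $d$-compatible if either they do not cross, or they are of the form $\overline{1j}$ and $\overline{i(n+3)}$ with $2\le i<j\le n+2$ and $j-i\ge d+1$. A $d$-admissible chord diagram is a maximal collection of pairwise $d$-compatible $d$-chords. For $n\ge 1$, $S^{(d)}_n$ is the number of $d$-admissible chord diagrams in the $(n+3)$-gon (the same definition being used when $d>n$); $S^{(d)}_0=1$ and $S^{(d)}_n=0$ for $n<0$. *)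

(* Defs.v *)
From mathcomp Require Import all_boot all_order all_algebra.

Set Implicit Arguments.
Unset Strict Implicit.
Unset Printing Implicit Defensive.

Import GRing.Theory.

(* The vertices of the (n+3)-gon are labelled 1, ..., n+3 in cyclic order: the
   ordinal v : 'I_(n + 3) stands for the vertex with label v.+1.  The segment
   with end labels i < j is stored as the pair of its ends in this order. *)
Definition segment (n : nat) : finType := ('I_(n + 3) * 'I_(n + 3))%type.

Definition lo n (c : segment n) : nat := c.1.+1.
Definition hi n (c : segment n) : nat := c.2.+1.

Definition dchords (d n : nat) : {set segment n} :=
  [set c | [|| [&& lo c == 1, 3 <= hi c & hi c <= n + 2],
               [&& hi c == n + 3, 2 <= lo c & lo c <= n + 1]
             | [&& 2 <= lo c, lo c < hi c, hi c <= n + 2,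
                   2 <= hi c - lo c & hi c - lo c <= d]]].

(* Crossing in the interior of the polygon: the four ends are distinct and
   alternate in the cyclic order. *)
Definition crossing n (c c' : segment n) : bool :=
  [&& lo c < lo c', lo c' < hi c & hi c < hi c']
  || [&& lo c' < lo c, lo c < hi c' & hi c' < hi c].

(* c is the segment 1j and c' is the segment i(n+3), with 2 <= i < j <= n+2
   and j - i >= d + 1. *)
Definition long_crossing (d n : nat) (c c' : segment n) : bool :=
  [&& lo c == 1, hi c' == n + 3,
      2 <= lo c', lo c' < hi c, hi c <= n + 2 & d + 1 <= hi c - lo c'].

Definition dcompatible (d n : nat) (c c' : segment n) : bool :=
  [|| ~~ crossing c c', long_crossing d c c' | long_crossing d c' c].

Definition pairwise_dcompatible (d n : nat) (D : {set segment n}) : bool :=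
  (D \subset dchords d n)
  && [forall c in D, forall c' in D, dcompatible d c c'].

Definition admissible_diagrams (d n : nat) : {set {set segment n}} :=
  [set D | maxset (@pairwise_dcompatible d n) D].

Definition nb_diagrams (d n : nat) : nat :=
  if n == 0 then 1 else #|admissible_diagrams d n|.

Local Open Scope ring_scope.

Definition catalan (k : nat) : rat := (k.+1)%:R^-1 * 'C((2 * k)%N, k)%:R.

(* Formal power series over the rationals, as coefficient sequences, compared
   pointwise. *)
Definition fps : Type := nat -> rat.

Definition fps_one : fps := fun n => (n == 0%N)%:R.

Definition fps_mul (f g : fps) : fps :=
  fun n => \sum_(i < n.+1) f i * g (n - i)%N.

Definition fps_of_poly (p : {poly rat}) : fps := fun n => p`_n.

Fixpoint fps_inv_coefs (f : fps) (n : nat) : seq rat :=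
  if n is m.+1 then
    let s := fps_inv_coefs f m in
    rcons s (- ((f 0%N)^-1 * \sum_(i < m.+1) f i.+1 * s`_(m - i)))
  else [:: (f 0%N)^-1].

(* The multiplicative inverse 1/f of a series f with f_0 <> 0; fps_mulV and
   fps_inv_unique show that it is the unique g with f g = 1. *)
Definition fps_inv (f : fps) : fps := fun n => (fps_inv_coefs f n)`_n.

Lemma size_fps_inv_coefs f n : size (fps_inv_coefs f n) = n.+1.
Proof. by elim: n => //= n IHn; rewrite size_rcons IHn. Qed.

Lemma nth_fps_inv_coefs f n m : (m <= n)%N ->
  (fps_inv_coefs f n)`_m = fps_inv f m.
Proof.
elim: n => [|n IHn]; first by rewrite leqn0 => /eqP->.
rewrite leq_eqVlt => /predU1P[-> //|]; rewrite ltnS => le_mn.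
by rewrite /= nth_rcons size_fps_inv_coefs ltnS le_mn IHn.
Qed.

Lemma fps_invS f n : fps_inv f n.+1 =
  - ((f 0%N)^-1 * \sum_(i < n.+1) f i.+1 * fps_inv f (n - i)%N).
Proof.
rewrite /fps_inv /= nth_rcons size_fps_inv_coefs ltnn eqxx.
congr (- (_ * _)); apply: eq_bigr => i _.
by rewrite nth_fps_inv_coefs // leq_subr.
Qed.

Lemma fps_mulV (f : fps) : f 0%N != 0 -> fps_mul f (fps_inv f) =1 fps_one.
Proof.
move=> f0 [|n]; rewrite /fps_mul /fps_one big_ord_recl /=.
  by rewrite big_ord0 addr0 mulfV.
by rewrite subn0 fps_invS mulrN mulrA mulfV // mul1r addNr.
Qed.

Lemma fps_inv_unique (f g : fps) :
  f 0%N != 0 -> fps_mul f g =1 fps_one -> g =1 fps_inv f.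
Proof.
move=> f0 fg1 n; elim/ltn_ind: n => -[|n] IHn; apply: (mulfI f0).
  have := fg1 0%N; rewrite /fps_mul big_ord_recl big_ord0 addr0 /= => ->.
  by rewrite /fps_inv mulfV.
have := fg1 n.+1; rewrite /fps_mul big_ord_recl /= subn0 => /eqP.
rewrite addr_eq0 => /eqP->; rewrite fps_invS mulrN mulrA mulfV // mul1r.
congr (- _); apply: eq_bigr => i _; rewrite /bump add1n subSS IHn //.
exact: leq_subr.
Qed.

Definition diagram_series (d : nat) : fps := fun n => (nb_diagrams d n)%:R.

(* Main.v *)
Require Import Defs.
From HB Require Import structures.
From mathcomp Require Import all_boot all_order all_algebra.
From mathcomp Require Import zify ring.

(** Number the vertices 1, ..., n+3 from 0, so that 0 and N = n + 2 are the two
special vertices and 1, ..., n + 1 the ordinary ones.  Call the chords at 0 left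
chords, the chords at N right chords, and the others inner chords.

In an admissible diagram, the ordinary vertices that lie strictly under no
inner chord cut the path 1, ..., n+1 into steps.  A step of length m is either
a side of the polygon (m = 1) or an inner chord (2 <= m <= d), below which the
diagram is a triangulation of an (m+1)-gon, that is, a binary tree with m
leaves.  Moreover, for each step from a to b exactly one of the left chord at b
and the right chord at a is present.  They cannot both be, because they cross
and b - a <= d.  If the left chord at b is absent, maximality provides a right
chord at some l < b with b - l <= d; for the largest such l, nothing in the
diagram can cross the inner chord from l to b, so this chord is present, and it
covers a unless l = a ([maximal_contains_word]).

So a diagram is a word of blocks, each block being a binary tree with m <= d
leaves and a letter (true for the left chord, false for the right one).  The
only constraint left is that a block false of length m followed by a block true
of length m' forces m + m' > d: if m + m' <= d, the right chord and the left
chord of these blocks are incompatible, and otherwise no chord can be added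
across their common end ([word_chords_maximal]).  Distinct such words have
incompatible chords ([word_chords_inj]), whence a bijection between words and
diagrams ([diagram_admissible], [diagram_inj], [diagram_onto]).

Counting the words: put an arbitrary block in front of a good word.  The result
fails to be good exactly when it starts with a block false and a block true of
total length M <= d; grafting their two trees on a common root gives an
arbitrary tree with M >= 2 leaves, followed by an arbitrary good word.  With
T = sum_(1 <= m <= d) C_(m-1) x^m, this says S - 1 = 2 T S - (T - x) S, i.e.
S (1 - x - T) = 1, and 1 - x - T is the denominator of the theorem
([size_words], [nb_diagrams_rec]).  That there are C_(m-1) trees with m leaves
is the convolution recurrence of the Catalan numbers, derived from their closed
form ([convolution_of_step]). *)

Set Implicit Arguments.
Unset Strict Implicit.
Unset Printing Implicit Defensive.

Import Order.TTheory GRing.Theory Num.Theory.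

(** * Binary trees as plane triangulations *)

Inductive tree : Type := Leaf | Node of tree & tree.

Fixpoint tree_code t : GenTree.tree unit :=
  if t is Node l r then GenTree.Node 0 [:: tree_code l; tree_code r]
  else GenTree.Leaf tt.

Fixpoint tree_decode (c : GenTree.tree unit) : option tree :=
  match c with
  | GenTree.Node _ [:: l; r] =>
    if (tree_decode l, tree_decode r) is (Some l', Some r')
    then Some (Node l' r') else None
  | _ => Some Leaf
  end.

Lemma tree_codeK : pcancel tree_code tree_decode.
Proof. by elim=> //= l -> r ->. Qed.

HB.instance Definition _ := Equality.copy tree (pcan_type tree_codeK).

Fixpoint leaves t := if t is Node l r then leaves l + leaves r else 1.

Lemma leaves_gt0 t : 0 < leaves t.
Proof. by elim: t => //= l lgt0 r _; rewrite addn_gt0 lgt0. Qed.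

(** A tree with m leaves triangulates the polygon a, a + 1, ..., a + m: each
inner node, whose leaves are the sides from x to y, contributes the chord
(x, y).  The chord of the root is included, since the two special vertices lie
beyond it. *)
Fixpoint tree_chords a t : seq (nat * nat) :=
  if t is Node l r then
    (a, a + leaves t) :: tree_chords a l ++ tree_chords (a + leaves l) r
  else [::].

Definition cross (c c' : nat * nat) : bool :=
  [&& c.1 < c'.1, c'.1 < c.2 & c.2 < c'.2]
  || [&& c'.1 < c.1, c.1 < c'.2 & c'.2 < c.2].

Lemma crossC c c' : cross c c' = cross c' c.
Proof. by rewrite /cross orbC. Qed.

Lemma tree_chords_bounds t a (c : nat * nat) : c \in tree_chords a t ->
  [/\ a <= c.1, c.1 + 2 <= c.2 & c.2 <= a + leaves t].
Proof.
elim: t a => //= l IHl r IHr a.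
have := leaves_gt0 l; have := leaves_gt0 r => r_gt0 l_gt0.
rewrite inE mem_cat => /or3P[/eqP->|/IHl|/IHr] /=; first by split; lia.
  by case=> ? ? ?; split; lia.
by case=> ? ? ?; split; lia.
Qed.

Lemma tree_chords_top t a : 2 <= leaves t -> (a, a + leaves t) \in tree_chords a t.
Proof. by case: t => //= l r _; rewrite mem_head. Qed.

Lemma tree_chords_plane t a :
  {in tree_chords a t &, forall c c', ~~ cross c c'}.
Proof.
elim: t a => //= l IHl r IHr a c c'.
have := leaves_gt0 l; have := leaves_gt0 r => r_gt0 l_gt0.
rewrite !inE !mem_cat => /or3P[/eqP->|cl|cr] /or3P[/eqP->|cl'|cr'].
- by rewrite /cross /=; lia.
- by have [] := tree_chords_bounds cl'; rewrite /cross /=; lia.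
- by have [] := tree_chords_bounds cr'; rewrite /cross /=; lia.
- by have [] := tree_chords_bounds cl; rewrite /cross /=; lia.
- exact: IHl cl cl'.
- have [? ? ?] := tree_chords_bounds cl.
  by have [] := tree_chords_bounds cr'; rewrite /cross /=; lia.
- by have [] := tree_chords_bounds cr; rewrite /cross /=; lia.
- have [? ? ?] := tree_chords_bounds cl'.
  by have [] := tree_chords_bounds cr; rewrite /cross /=; lia.
- exact: IHr cr cr'.
Qed.

(** This is the maximality of a triangulation: a chord crossing neither the
chord of the left subtree nor that of the right one lies in one of the two
subpolygons, or joins the ends of the whole polygon. *)
Lemma tree_chords_maximal t a x y :
  a <= x -> x + 2 <= y -> y <= a + leaves t ->
  {in tree_chords a t, forall c, ~~ cross (x, y) c} ->
  (x, y) \in tree_chords a t.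
Proof.
elim: t a => [|l IHl r IHr] a ax xy yt xyP; first by move: yt => /=; lia.
have := leaves_gt0 l; have := leaves_gt0 r => r_gt0 l_gt0.
have [/eqP xyE|xyN] := boolP ((x, y) == (a, a + leaves (Node l r))).
  by rewrite xyE mem_head.
have lP : {in tree_chords a l, forall c, ~~ cross (x, y) c}.
  by move=> c cl; apply: xyP; rewrite /= inE mem_cat cl orbT.
have rP : {in tree_chords (a + leaves l) r, forall c, ~~ cross (x, y) c}.
  by move=> c cr; apply: xyP; rewrite /= inE mem_cat cr !orbT.
rewrite /= inE mem_cat; rewrite /= in yt.
have [yl|ly] := leqP y (a + leaves l); first by rewrite IHl ?orbT.
have [lx|xl] := leqP (a + leaves l) x.
  by rewrite IHr ?orbT //; lia.
have ll : x = a.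
  have [l2|l1] := leqP 2 (leaves l); last by lia.
  by have := lP _ (tree_chords_top a l2); rewrite /cross /=; lia.
have yE : y = a + leaves (Node l r).
  have [r2|r1] := leqP 2 (leaves r); last by move=> /=; lia.
  by have := rP _ (tree_chords_top _ r2); rewrite /cross /=; lia.
by rewrite ll yE eqxx in xyN.
Qed.

(** Crossing-free union, rather than equality of the sets of chords, is what
passes to the subtrees without any description of which chords belong to
which. *)
Lemma tree_chords_inj t t' a : leaves t = leaves t' ->
  {in tree_chords a t & tree_chords a t', forall c c', ~~ cross c c'} -> t = t'.
Proof.
elim: t t' a => [|l IHl r IHr] [|l' r'] a //=.
- by have := leaves_gt0 l'; have := leaves_gt0 r'; lia.
- by have := leaves_gt0 l; have := leaves_gt0 r; lia.
move=> sz ncr.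
have := leaves_gt0 l; have := leaves_gt0 r => r_gt0 l_gt0.
have := leaves_gt0 l'; have := leaves_gt0 r' => r'_gt0 l'_gt0.
have szl : leaves l = leaves l'.
  have [lt|gt|//] := ltngtP (leaves l) (leaves l').
    suff: ~~ cross (a + leaves l, a + leaves l + leaves r) (a, a + leaves l').
      by rewrite /cross /=; lia.
    by apply: ncr; rewrite inE mem_cat tree_chords_top ?orbT //; lia.
  suff: ~~ cross (a, a + leaves l) (a + leaves l', a + leaves l' + leaves r').
    by rewrite /cross /=; lia.
  by apply: ncr; rewrite inE mem_cat tree_chords_top ?orbT //; lia.
congr Node.
  apply: (IHl _ a) => // c c' cl cl'.
  by apply: ncr; rewrite inE mem_cat ?cl ?cl' ?orbT.
apply: (IHr _ (a + leaves l)) => [|c c' cr cr']; first by lia.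
by apply: ncr; rewrite inE mem_cat ?cr -?szl ?cr' ?orbT.
Qed.

(** * Words of blocks and their chords *)

(** The number v stands for the vertex v + 1 of the polygon, hence 0 and [N] for
the special vertices 1 and n + 3. *)
Definition chord d N (c : nat * nat) : bool :=
  [|| [&& c.1 == 0, 2 <= c.2 & c.2 < N],
      [&& c.2 == N, 1 <= c.1 & c.1 + 2 <= N]
    | [&& 1 <= c.1, c.1 + 2 <= c.2, c.2 < N & c.2 <= c.1 + d]].

Definition long_cross d N (c c' : nat * nat) : bool :=
  [&& c.1 == 0, c'.2 == N, 0 < c'.1, c.2 < N & c'.1 + d < c.2].

Definition compatible d N c c' : bool :=
  [|| ~~ cross c c', long_cross d N c c' | long_cross d N c' c].

Lemma compatibleC d N c c' : compatible d N c c' = compatible d N c' c.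
Proof. by rewrite /compatible crossC [_ || long_cross _ _ _ _]orbC. Qed.

(** The letter of a block from a to b is true when it carries the left chord at
b, and false when it carries the right chord at a. *)
Definition block : Type := bool * tree.

Definition width (w : seq block) : nat := sumn [seq leaves u.2 | u <- w].

Fixpoint word_chords N a (w : seq block) : seq (nat * nat) :=
  if w is u :: w' then
    (if u.1 then (0, a + leaves u.2) else (a, N))
      :: tree_chords a u.2 ++ word_chords N (a + leaves u.2) w'
  else [::].

(** The right chord at the beginning of [u] crosses the left chord at the end of
[v]; this is allowed when the two blocks span more than [d]. *)
Definition far d (u v : block) : bool :=
  ~~ u.1 && v.1 ==> (d < leaves u.2 + leaves v.2).

Fixpoint good d (w : seq block) : bool :=
  if w is u :: w' then
    [&& leaves u.2 <= d, (if w' is v :: _ then far d u v else true) & good d w']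
  else true.

(** Used at the end of the first block, this separates the chords of that block
from the chords of the rest of the word. *)
Lemma word_chords_right N w a (c : nat * nat) : 0 < a -> c \in word_chords N a w ->
  (c.1 == 0) && (a < c.2) || (a <= c.1).
Proof.
elim: w a => //= -[s t] w IHw a a_gt0; have t_gt0 := leaves_gt0 t.
rewrite inE mem_cat => /or3P[/eqP->|/tree_chords_bounds[]|/(IHw (a + leaves t))].
- by case: s => /=; lia.
- by lia.
by lia.
Qed.

Lemma word_chords_chord d N w a (c : nat * nat) :
  0 < a -> a + width w + 1 = N -> good d w ->
  c \in word_chords N a w -> chord d N c.
Proof.
elim: w a => //= -[s t] w IHw a a_gt0; rewrite /width /= => wN /and3P[td _ gw].
have t_gt0 := leaves_gt0 t.
rewrite inE mem_cat => /or3P[/eqP->|/tree_chords_bounds[]|/(IHw (a + leaves t))].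
- by rewrite /chord; case: s => /=; lia.
- by rewrite /chord; lia.
by apply=> //; rewrite /width; lia.
Qed.

(** The constraint on adjacent blocks is enough to control all the pairs: from a
right chord at [a] to any later left chord, the letters change from false to
true at some adjacent pair of blocks, which already spans more than [d]. *)
Lemma far_left_chord d N w a t k : good d ((false, t) :: w) -> 0 < a ->
  (0, k) \in word_chords N (a + leaves t) w -> a + d < k.
Proof.
elim: w a t => // -[s t'] w IHw a t /and3P[/= _ far_t gw] a_gt0.
have t_gt0 := leaves_gt0 t; have t'_gt0 := leaves_gt0 t'.
rewrite inE mem_cat; case: s far_t gw => [far_t gw|_ gw].
  case/or3P=> [/eqP[->]|/tree_chords_bounds[/=]|].
  - by move: far_t; rewrite /far /=; lia.
  - by lia.
  move/word_chords_right; move: far_t; rewrite /far /=; lia.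
case/or3P=> [/eqP[]|/tree_chords_bounds[/=]|/(IHw _ _ gw)]; by lia.
Qed.

Lemma word_chords_compatible d N w a : 0 < a -> a + width w + 1 = N ->
  good d w -> {in word_chords N a w &, forall c c', compatible d N c c'}.
Proof.
elim: w a => //= -[s t] w IHw a a_gt0; rewrite /width /= => wN gsw.
have /and3P[/= td _ gw] := gsw.
have t_gt0 := leaves_gt0 t.
have wN' : a + leaves t + width w + 1 = N by rewrite /width; lia.
have b_gt0 : 0 < a + leaves t by lia.
set u := (if s then _ else _).
have ut c : c \in tree_chords a t -> compatible d N u c.
  move/tree_chords_bounds=> [? ? ?]; rewrite /compatible /cross /u.
  by case: (s) => /=; lia.
have uw c : c \in word_chords N (a + leaves t) w -> compatible d N u c.
  move=> cw; have := word_chords_right b_gt0 cw.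
  have := word_chords_chord b_gt0 wN' gw cw.
  case: c cw => x y cw; rewrite /u; case: (s) gsw => gsw.
    by rewrite /compatible /chord /cross /=; lia.
  case: x cw => [|x] cw; last by rewrite /compatible /chord /cross /=; lia.
  have := far_left_chord gsw a_gt0 cw.
  by rewrite /compatible /chord /cross /long_cross /=; lia.
have tw c c' : c \in tree_chords a t -> c' \in word_chords N (a + leaves t) w ->
    compatible d N c c'.
  move=> /tree_chords_bounds[? ? ?] c'w; have := word_chords_right b_gt0 c'w.
  by rewrite /compatible /cross; lia.
have uu : compatible d N u u by rewrite /compatible /cross; lia.
move=> c c'; rewrite !inE !mem_cat.
case/or3P=> [/eqP->|ct|cw] /or3P[/eqP->|c't|c'w] //; auto.
- by rewrite compatibleC; auto.
- by rewrite /compatible (tree_chords_plane ct c't).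
- by rewrite compatibleC; auto.
- by rewrite compatibleC; auto.
exact: IHw wN' gw _ _ cw c'w.
Qed.

(** A new chord with an end inside a block crosses the top chord of this block.
A left or right chord with its end between two blocks is present or faces the
opposite chord of a block.  An inner chord passing over the common end of two
blocks crosses the left or the right chord there, unless the letters are false
then true, in which case it is longer than [d] or cuts the second block. *)
Lemma word_chords_maximal d N w a (c : nat * nat) : 0 < a -> a + width w + 1 = N ->
  good d w -> chord d N c -> (c.1 == 0) && (a < c.2) || (a <= c.1) ->
  {in word_chords N a w, forall c', compatible d N c c'} ->
  c \in word_chords N a w.
Proof.
case: c => x y; elim: w a => [|[s t] w IHw] a a_gt0; rewrite /width /= => wN.
  by rewrite /chord /=; lia.
move=> gsw cxy axy xyP.
have /and3P[/= td far_t gw] := gsw.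
have t_gt0 := leaves_gt0 t.
set b := a + leaves t in xyP *.
have wN' : b + width w + 1 = N by rewrite /b /width; lia.
have b_gt0 : 0 < b by lia.
have uP := xyP _ (mem_head _ _).
have tP : {in tree_chords a t, forall c', compatible d N (x, y) c'}.
  by move=> c' c't; apply: xyP; rewrite inE mem_cat c't orbT.
have wP : {in word_chords N b w, forall c', compatible d N (x, y) c'}.
  by move=> c' c'w; apply: xyP; rewrite inE mem_cat c'w !orbT.
have topP : 2 <= leaves t -> compatible d N (x, y) (a, b).
  by move=> t2; apply: tP; apply: tree_chords_top.
rewrite inE mem_cat.
have [xyw|xyNw] := boolP ((x == 0) && (b < y) || (b <= x)).
  by rewrite (IHw b) ?orbT.
have [//|xyNu] := boolP ((x, y) == if s then (0, b) else (a, N)).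
apply/orP; right; apply/orP; left.
have [x0|x_gt0] := posnP x.
  exfalso; move: xyNu uP topP cxy axy xyNw; rewrite x0.
  by case: (s); rewrite /compatible /cross /long_cross /chord /b /= ?xpair_eqE; lia.
have [yN|yNN] := eqVneq y N.
  exfalso; move: xyNu uP topP cxy axy xyNw; rewrite yN.
  by case: (s); rewrite /compatible /cross /long_cross /chord /b /= ?xpair_eqE; lia.
have [yb|by_] := leqP y b.
  apply: tree_chords_maximal => // [||c' c't]; first by lia.
  - by move: cxy; rewrite /chord /=; lia.
  have := tP _ c't; have [? ? ?] := tree_chords_bounds c't.
  by rewrite /compatible /long_cross /= => /or3P[//||]; lia.
have xa : x = a.
  move: topP cxy axy xyNw; rewrite /compatible /cross /long_cross /chord /b /=.
  by lia.
exfalso.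
have yN : y < N by move: cxy; rewrite /chord /=; lia.
case: w far_t wN wP {IHw gsw gw td tP wN' xyP} => [|[s' t'] w] /= far_t wN wP.
  by lia.
have t'_gt0 := leaves_gt0 t'.
have := wP _ (mem_head _ _).
have topP' : 2 <= leaves t' -> compatible d N (x, y) (b, b + leaves t').
  by move=> t2; apply: wP; rewrite inE mem_cat tree_chords_top ?orbT.
move: far_t uP topP' cxy; rewrite /far /compatible /cross /chord /long_cross /= xa.
by case: (s); case: (s') => /=; rewrite ?implybT /b; lia.
Qed.

(** Compatible words have the same first block: by maximality the top chord of
one first block is a chord of the other word, so no first block is longer than
the other.  The trees then agree by [tree_chords_inj], and the letters because
the two chords of a block are incompatible. *)
Lemma word_chords_inj d N w w' a : 0 < a ->
  a + width w + 1 = N -> a + width w' + 1 = N -> good d w -> good d w' ->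
  {in word_chords N a w & word_chords N a w',
    forall c c', compatible d N c c'} -> w = w'.
Proof.
elim: w w' a => [|[s t] w IHw] [|[s' t'] w'] a a_gt0 wN wN' gw gw' com //.
- by move: wN wN'; rewrite /width /=; have := leaves_gt0 t'; lia.
- by move: wN wN'; rewrite /width /=; have := leaves_gt0 t; lia.
have t_gt0 := leaves_gt0 t; have t'_gt0 := leaves_gt0 t'.
have first_block s1 t1 w1 s2 t2 w2 : a + width ((s1, t1) :: w1) + 1 = N ->
    a + width ((s2, t2) :: w2) + 1 = N -> good d ((s1, t1) :: w1) ->
    good d ((s2, t2) :: w2) ->
    {in word_chords N a ((s1, t1) :: w1) & word_chords N a ((s2, t2) :: w2),
      forall c c', compatible d N c c'} ->
    leaves t2 <= leaves t1.
  move=> w1N w2N gw1 gw2 com12; have t1_gt0 := leaves_gt0 t1.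
  have [t2_small|t2_big] := leqP (leaves t2) 1; first by lia.
  have top2 : (a, a + leaves t2) \in word_chords N a ((s2, t2) :: w2).
    by rewrite /= inE mem_cat tree_chords_top ?orbT.
  have: (a, a + leaves t2) \in word_chords N a ((s1, t1) :: w1).
    apply: (word_chords_maximal a_gt0 w1N gw1) => [||c cw].
    - exact: word_chords_chord a_gt0 w2N gw2 top2.
    - by rewrite /= leqnn orbT.
    by rewrite compatibleC; apply: com12.
  have b_gt0 : 0 < a + leaves t1 by lia.
  rewrite /= inE mem_cat => /or3P[/eqP|/tree_chords_bounds[]|].
  - by case: (s1) => -[]; move: w2N; rewrite /width /=; lia.
  - by rewrite /=; lia.
  by move/(word_chords_right b_gt0); rewrite /=; lia.
have tt' : leaves t = leaves t'.
  apply/eqP; rewrite eqn_leq (first_block _ _ _ _ _ _ wN wN' gw gw' com).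
  rewrite (first_block _ _ _ _ _ _ wN' wN gw' gw) // => c c' cw c'w.
  by rewrite compatibleC; apply: com.
have Et : t = t'.
  apply: (@tree_chords_inj _ _ a) => // c c' ct c't.
  have : compatible d N c c'.
    by apply: com; rewrite /= inE mem_cat ?ct ?c't ?orbT.
  have [? ? ?] := tree_chords_bounds ct; have [? ? ?] := tree_chords_bounds c't.
  by rewrite /compatible /long_cross => /or3P[//||]; lia.
have /and3P[/= td _ gtw] := gw.
have /and3P[/= _ _ gtw'] := gw'.
have Es : s = s'.
  have := com _ _ (mem_head _ _) (mem_head _ _); move: wN.
  rewrite /width /compatible /cross /long_cross -?Et.
  by case: (s); case: (s') => //=; lia.
rewrite -Es -Et in wN' com gw' *; congr cons.
move: wN wN'; rewrite /width /= !addnA => wN wN'.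
apply: IHw wN wN' _ _ _ => // [|c c' cw c'w]; first by lia.
by apply: com; rewrite /= inE mem_cat ?cw ?c'w ?orbT.
Qed.

(** * From a maximal compatible set to a word *)

Section Decomposition.

Variables (d N : nat) (D : pred (nat * nat)).
Hypothesis d_gt0 : 0 < d.
Hypothesis D_chord : forall c, D c -> chord d N c.
Hypothesis D_compatible : forall c c', D c -> D c' -> compatible d N c c'.
Hypothesis D_maximal :
  forall c, chord d N c -> (forall c', D c' -> compatible d N c c') -> D c.

Definition edge x y := (y == x.+1) || D (x, y).

(** The apex over the edge from a to b is the largest c < b joined to a: any
chord separating c from b would cross (a, b) or (a, c), or contradict the choice
of c. *)
Lemma maximal_contains_tree a b : 0 < a -> a < b -> b < N -> b <= a + d -> edge a b ->
  exists2 t, leaves t = b - a & {subset tree_chords a t <= D}.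
Proof.
have [n] := ubnP (b - a); elim: n a b => // n IHn a b ban a_gt0 ab bN bad eab.
have [ba1|ba2] := leqP b a.+1; first by exists Leaf => //=; lia.
have Dab : D (a, b) by move: eab; rewrite /edge => /predU1P[?|//]; lia.
pose P := [pred c | (a < c < b) && edge a c].
have exP : exists c, P c by exists a.+1; rewrite /= /edge eqxx; lia.
have ubP c : P c -> c <= b by rewrite /=; lia.
case: (ex_maxnP exP ubP) => c /= /andP[acb eac] cmax.
have ecb : edge c b.
  rewrite /edge; have [//|bc] := eqVneq b c.+1; rewrite orFb.
  apply: D_maximal => [|[x y] Dxy]; first by rewrite /chord /=; lia.
  have := D_compatible Dab Dxy; have := D_chord Dxy.
  have xc : D (a, c) -> compatible d N (a, c) (x, y).
    by move=> Dac; apply: D_compatible.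
  have ya : x = a -> y < b -> y <= c.
    move=> xa yb; have [ya|ay] := leqP y a; first by lia.
    have Day : D (a, y) by rewrite -xa.
    by apply: cmax; rewrite /edge Day orbT; lia.
  move: eac; rewrite /edge => /predU1P[Ec|/xc];
  rewrite /compatible /chord /cross /long_cross /=; lia.
have [|||||l ll lD] := IHn a c _ _ _ _ _ eac; try lia.
have [|||||r lr rD] := IHn c b _ _ _ _ _ ecb; try lia.
exists (Node l r) => /= [|xy]; first by lia.
rewrite inE mem_cat ll lr => /or3P[/eqP->|/lD//|].
  by rewrite (_ : a + _ = b) //; lia.
by rewrite (_ : a + _ = c) ?[a + _]subnKC //; [move/rD | lia].
Qed.

Definition exposed a := forall x y, D (x, y) -> x < a < y -> (x == 0) || (y == N).

(** The first block ends at the largest b joined to a, which is then exposed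
too.  Its letter is true unless some right chord forbids the left chord at b,
and then the last such right chord has to start at a. *)
Lemma maximal_contains_word a : 0 < a -> a < N -> exposed a ->
  exists w, [/\ a + width w + 1 = N, good d w & {subset word_chords N a w <= D}].
Proof.
have [n] := ubnP (N - a); elim: n a => // n IHn a aNn a_gt0 aN ea.
have [aN1|aN2] := leqP N a.+1; first by exists [::]; split=> //; rewrite /width /=; lia.
pose P := [pred c | (a < c < N) && edge a c].
have exP : exists c, P c by exists a.+1; rewrite /= /edge eqxx; lia.
have ubP c : P c -> c <= N by rewrite /=; lia.
case: (ex_maxnP exP ubP) => b /= /andP[/andP[ab bN] eab] bmax.
have bad : b <= a + d.
  move: eab; rewrite /edge => /predU1P[|/D_chord]; last by rewrite /chord /=; lia.
  by lia.
have eb : exposed b.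
  move=> x y Dxy /andP[xb yb]; have [xa|ax|xa] := ltngtP x a.
  - by have [?|?] := leqP y a; [lia | apply: ea Dxy _; lia].
  - move: eab; rewrite /edge => /predU1P[|Dab]; first by lia.
    have := D_compatible Dab Dxy; have := D_chord Dxy.
    by rewrite /compatible /chord /cross /long_cross /=; lia.
  have [_|yN] := eqVneq y N; first by rewrite orbT.
  have Day : D (a, y) by rewrite -xa.
  have : y <= b.
    apply: bmax; rewrite /edge Day orbT andbT.
    by have := D_chord Dxy; rewrite /chord /=; lia.
  by lia.
have [||w [wN gw wD]] := IHn b _ _ bN eb; try lia.
have [t lt tD] := maximal_contains_tree a_gt0 ab bN bad eab.
have [s sD] : exists s, D (if s then (0, b) else (a, N)).
  have [Db|nDb] := boolP (D (0, b)); first by exists true.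
  exists false; apply: contraNT nDb => nDa.
  apply: D_maximal => [|[x y] Dxy]; first by rewrite /chord /=; lia.
  have [//|ncomp] := boolP (compatible d N (0, b) (x, y)).
  have /andP[/eqP yN xb] : [&& y == N, 0 < x, x < b & b <= x + d].
    have := eb _ _ Dxy; have := D_chord Dxy; move: ncomp.
    by rewrite /compatible /chord /cross /long_cross /=; lia.
  (* The largest l makes the chord (l, b) addable: a right chord strictly between
     its ends would start after l, and a left chord there is incompatible with
     the right chord at l. *)
  pose Q := [pred l | (l < b) && D (l, N)].
  have DxN : D (x, N) by rewrite -yN.
  have exQ : exists l, Q l by exists x; rewrite /= DxN; lia.
  have ubQ l : Q l -> l <= b by rewrite /=; lia.
  case: (ex_maxnP exQ ubQ) => l /= /andP[lb Dl] lmax.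
  have xl : x <= l by apply: lmax; rewrite DxN; lia.
  have la : l < a.
    have [//|al|la] := ltngtP l a; last by rewrite la (negPf nDa) in Dl.
    move: eab; rewrite /edge => /predU1P[|Dab]; first by lia.
    have := D_compatible Dab Dl.
    by rewrite /compatible /cross /long_cross /=; lia.
  have Dlb : D (l, b).
    apply: D_maximal => [|[x' y'] Dxy']; first by rewrite /chord /=; lia.
    have := eb _ _ Dxy'; have := D_chord Dxy'; have := D_compatible Dl Dxy'.
    have : y' = N -> x' < b -> x' <= l.
      by move=> y'N x'b; apply: lmax; rewrite -y'N Dxy' andbT.
    by rewrite /compatible /chord /cross /long_cross /=; lia.
  by have := ea _ _ Dlb; lia.
exists ((s, t) :: w).
have btE : a + leaves t = b by lia.
have wD' : {subset word_chords N a ((s, t) :: w) <= D}.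
  move=> c; rewrite /= inE mem_cat btE => /or3P[/eqP->//|/tD//|/wD//].
split=> //; first by move: wN; rewrite /width /=; lia.
rewrite /= gw andbT; apply/andP; split; first by lia.
case: w gw wN wD wD' => [//|[s' t'] w] _ wN _ wD'.
rewrite /far /=; apply/implyP => /andP[/negPf sF s'T].
have Da : D (a, N) by apply: wD'; rewrite /= sF mem_head.
have Db : D (0, a + leaves t + leaves t').
  by apply: wD'; rewrite /= sF s'T !(inE, mem_cat) eqxx !orbT.
have t'_gt0 := leaves_gt0 t'.
have := D_compatible Da Db; move: wN; rewrite /width /=.
by rewrite /compatible /cross /long_cross /=; lia.
Qed.

End Decomposition.

(** * Diagrams of the polygon are good words *)

Section Diagrams.

Variables (d n : nat).
Hypothesis d_gt0 : 0 < d.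
Let N := n + 2.

Definition ends (c : segment n) : nat * nat := (val c.1, val c.2).

Lemma ends_inj : injective ends.
Proof. by case=> [x y] [x' y'] [/val_inj-> /val_inj->]. Qed.

Lemma mem_dchords c : (c \in dchords d n) = chord d N (ends c).
Proof. rewrite inE /chord /lo /hi /N /=; lia. Qed.

Lemma dcompatibleE (c c' : segment n) :
  dcompatible d c c' = compatible d N (ends c) (ends c').
Proof.
rewrite /dcompatible /compatible /crossing /cross /long_crossing /long_cross.
by rewrite /lo /hi /N /=; lia.
Qed.

Lemma ends_onto xy : chord d N xy -> exists c, ends c = xy.
Proof.
case: xy => x y; rewrite /chord /= => xyP.
have xn : x < n + 3 by move: xyP; rewrite /N; lia.
have yn : y < n + 3 by move: xyP; rewrite /N; lia.
by exists (Ordinal xn, Ordinal yn).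
Qed.

Definition diagram (w : seq block) : {set segment n} :=
  [set c | ends c \in word_chords N 1 w].

Definition good_word w := good d w && (width w == n).

Lemma pairwiseP (A : {set segment n}) :
  reflect ({in A, forall c, chord d N (ends c)} /\
           {in A &, forall c c', compatible d N (ends c) (ends c')})
          (pairwise_dcompatible d A).
Proof.
apply: (iffP andP) => -[Ad Ac]; split.
- by move=> c cA; rewrite -mem_dchords (subsetP Ad).
- move=> c c' cA c'A; rewrite -dcompatibleE.
  by have /forall_inP/(_ c cA)/forall_inP := Ac; apply.
- by apply/subsetP=> c cA; rewrite mem_dchords Ad.
by apply/forall_inP=> c cA; apply/forall_inP=> c' c'A; rewrite dcompatibleE Ac.
Qed.

Lemma diagram_admissible w : good_word w -> diagram w \in admissible_diagrams d n.
Proof.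
case/andP=> gw /eqP wn; have wN : 1 + width w + 1 = N by rewrite /N; lia.
rewrite inE; apply/maxsetP; split.
  apply/pairwiseP; split=> [c|c c']; rewrite !inE.
    exact: word_chords_chord.
  exact: word_chords_compatible.
move=> B /pairwiseP[Bd Bc] wB; apply/eqP; rewrite eqEsubset wB andbT.
apply/subsetP=> c cB; rewrite inE.
have cd := Bd _ cB.
apply: (word_chords_maximal _ wN gw cd) => // [|xy xyw].
  by move: cd; rewrite /chord; lia.
have [c' c'E] := ends_onto (word_chords_chord (ltn0Sn 0) wN gw xyw).
by rewrite -c'E; apply: Bc => //; apply: (subsetP wB); rewrite inE c'E.
Qed.

Lemma diagram_inj : {in good_word &, injective diagram}.
Proof.
move=> w w' /andP[gw /eqP wn] /andP[gw' /eqP wn'] ww'.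
have wN : 1 + width w + 1 = N by rewrite /N; lia.
have wN' : 1 + width w' + 1 = N by rewrite /N; lia.
apply: (word_chords_inj (ltn0Sn 0) wN wN' gw gw') => xy xy' xyw xyw'.
have [c cE] := ends_onto (word_chords_chord (ltn0Sn 0) wN' gw' xyw').
apply: (word_chords_compatible (ltn0Sn 0) wN gw) => //.
by move/setP/(_ c): ww'; rewrite !inE cE xyw'.
Qed.

(** It suffices to find the chords of a good word inside the diagram, since they
already form a maximal compatible set. *)
Lemma diagram_onto A : A \in admissible_diagrams d n ->
  exists2 w, good_word w & A = diagram w.
Proof.
rewrite inE => Amax; have /maxsetP[/pairwiseP[Ad Ac] AM] := Amax.
pose D := [pred xy | [exists c in A, ends c == xy]].
have DP xy : reflect (exists2 c, c \in A & ends c = xy) (D xy).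
  apply: (iffP exists_inP) => -[c cA /eqP]; first by exists c => //; apply/eqP.
  by exists c.
have [|||xy xyd xyM||||w [wN gw wD]] := @maximal_contains_word d N D _ _ _ _ 1.
- by [].
- by move=> xy /DP[c cA <-]; apply: Ad.
- by move=> xy xy' /DP[c cA <-] /DP[c' c'A <-]; apply: Ac.
- have [c cE] := ends_onto xyd; apply/DP; exists c => //.
  have cself : compatible d N (ends c) (ends c).
    by rewrite /compatible /cross; lia.
  rewrite -(AM (c |: A)) ?setU11 ?subsetUr //; apply/pairwiseP; split.
    by move=> c'; rewrite !inE => /predU1P[->|/Ad//]; rewrite cE.
  have cA c' : c' \in A -> compatible d N (ends c) (ends c').
    by move=> c'A; rewrite cE; apply: xyM; apply/DP; exists c'.
  move=> c1 c2; rewrite !inE => /predU1P[->|c1A] /predU1P[->|c2A] //; auto.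
  by rewrite compatibleC; auto.
- by [].
- by rewrite /N; lia.
- by move=> x y /DP[c /Ad cd cE]; move: cd; rewrite cE /chord /=; lia.
have gww : good_word w by rewrite /good_word gw; move: wN; rewrite /N; lia.
exists w => //; have := diagram_admissible gww; rewrite inE => /maxsetP[_].
apply; first exact: maxsetp Amax.
apply/subsetP=> c; rewrite inE => /wD /DP[c' c'A /ends_inj <-//].
Qed.

End Diagrams.

(** * Enumeration of trees and words *)

Section Graded.

Variables (A B C : eqType) (op : A -> B -> C) (X : nat -> seq A) (Y : nat -> seq B).

(** Both trees and words of a given size are obtained by combining an object of
size i with an object of the complementary size, for i in some range. *)
Definition graded_pairs (r : seq nat) : seq C :=
  flatten [seq [seq op x y | x <- X i, y <- Y i] | i <- r].

Lemma graded_pairsP r c :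
  reflect (exists i x y, [/\ i \in r, x \in X i, y \in Y i & c = op x y])
          (c \in graded_pairs r).
Proof.
apply: (iffP flatten_mapP) => [[i ir /allpairsP[[x y] [xi yi ->]]]|].
  by exists i, x, y.
by case=> i [x [y [ir xi yi ->]]]; exists i => //; apply: allpairs_f.
Qed.

Lemma size_graded_pairs r :
  size (graded_pairs r) = \sum_(i <- r) size (X i) * size (Y i).
Proof.
rewrite size_flatten /shape -map_comp sumnE big_map.
by apply: eq_bigr => i _; rewrite /= size_allpairs.
Qed.

Lemma graded_pairs_uniq (grade : A -> nat) r : uniq r ->
  {in r, forall i, uniq (X i)} -> {in r, forall i, uniq (Y i)} ->
  (forall i x, i \in r -> x \in X i -> grade x = i) ->
  (forall i i' x x' y y', i \in r -> i' \in r -> x \in X i -> x' \in X i' ->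
     op x y = op x' y' -> x = x' /\ y = y') ->
  uniq (graded_pairs r).
Proof.
move=> Ur UX UY gX op_inj; rewrite /graded_pairs.
elim: r Ur UX UY gX op_inj => //= i r IHr /andP[ir Ur] UX UY gX op_inj.
rewrite cat_uniq; apply/and3P; split.
- apply: allpairs_uniq; rewrite ?UX ?UY ?mem_head // => -[x y] [x' y'].
  case/allpairsP=> -[x0 y0] /= [xi _ [-> ->]].
  case/allpairsP=> -[x1 y1] /= [x'i _ [-> ->]] eq_op.
  by case: (op_inj i i _ _ _ _ (mem_head _ _) (mem_head _ _) xi x'i eq_op) => -> ->.
- apply/hasPn=> c /graded_pairsP[j [x [y [jr xj _ ->]]]].
  apply/negP=> /allpairsP[[x' y'] /= [xi _ eq_op]].
  have jir : j \in i :: r by rewrite inE jr orbT.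
  have [Ex _] := op_inj _ _ _ _ _ _ jir (mem_head _ _) xj xi eq_op.
  by move: ir; rewrite -(gX i x') ?mem_head // -Ex (gX j) ?jr.
have jir j : j \in r -> j \in i :: r by rewrite inE orbC => ->.
apply: IHr => // [j /jir|j /jir|j x /jir|j j' x x' y y' /jir jr /jir]; auto.
exact: op_inj.
Qed.

End Graded.

(** The bound [f] on the depth of the recursion makes it structural; its value
does not matter once [m <= f]. *)
Fixpoint trees_upto f m : seq tree :=
  if f is f'.+1 then
    if m == 1 then [:: Leaf]
    else graded_pairs Node (trees_upto f') (fun i => trees_upto f' (m - i))
           (iota 1 m.-1)
  else [::].

Definition trees m := trees_upto m m.

Lemma eq_graded_pairs (A B C : eqType) (op : A -> B -> C) X Y X' Y' r :
  {in r, X =1 X'} -> {in r, Y =1 Y'} ->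
  graded_pairs op X Y r = graded_pairs op X' Y' r.
Proof.
by move=> eX eY; congr flatten; apply/eq_in_map => i ir; rewrite eX ?eY.
Qed.

Lemma trees_uptoE f m : m <= f -> trees_upto f m = trees m.
Proof.
rewrite /trees; have [n] := ubnP m.
elim: n m f => // n IHn [|m] [|f] //=.
rewrite !ltnS => mn mf; case: ifP => // m1.
apply: eq_graded_pairs => i; rewrite mem_iota => ir.
  by rewrite (IHn i f) ?(IHn i m) //; lia.
by rewrite (IHn (m.+1 - i) f) ?(IHn (m.+1 - i) m) //; lia.
Qed.

Lemma treesE m : 1 < m ->
  trees m = graded_pairs Node trees (fun i => trees (m - i)) (iota 1 m.-1).
Proof.
case: m => [|[|m]] // _.
have -> : trees m.+2 = graded_pairs Node (trees_upto m.+1)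
    (fun i => trees_upto m.+1 (m.+2 - i)) (iota 1 m.+1) by [].
by apply: eq_graded_pairs => i; rewrite mem_iota => ir; apply: trees_uptoE; lia.
Qed.

Lemma mem_trees m t : (t \in trees m) = (leaves t == m).
Proof.
elim: t m => [|l IHl r IHr] m.
  have [m_small|m_big] := leqP m 1; first by case: m m_small => [|[|]].
  rewrite treesE //= [RHS](_ : _ = false); last by lia.
  by apply/negP=> /graded_pairsP[i [x [y [_ _ _]]]].
have := leaves_gt0 l; have := leaves_gt0 r => r_gt0 l_gt0 /=.
have [m_small|m_big] := leqP m 1.
  rewrite [RHS](_ : _ = false); last by lia.
  by case: m m_small => [|[|]].
rewrite treesE //; apply/graded_pairsP/eqP => [[i [x [y [ir xi yi]]]]|lr].
  case=> El Er; move: xi yi ir; rewrite -El -Er IHl IHr mem_iota.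
  by lia.
exists (leaves l), l, r; rewrite IHl IHr mem_iota; split=> //; lia.
Qed.

Lemma trees_uniq m : uniq (trees m).
Proof.
elim/ltn_ind: m => m IHm; have [m_small|m_big] := leqP m 1.
  by case: m m_small {IHm} => [|[|]].
rewrite treesE //.
apply: (@graded_pairs_uniq _ _ _ _ _ _ leaves).
- exact: iota_uniq.
- by move=> i; rewrite mem_iota => im; apply: IHm; lia.
- by move=> i; rewrite mem_iota => im; apply: IHm; lia.
- by move=> i x _; rewrite mem_trees => /eqP.
by move=> i i' x x' y y' _ _ _ _ [-> ->].
Qed.

Section Words.

Variable d : nat.

Definition block_candidates (m : nat) : seq block :=
  [seq (s, t) | s <- [:: true; false], t <- trees m].

Fixpoint words_upto f n : seq (seq block) :=
  if f is f'.+1 then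
    if n == 0 then [:: [::]]
    else [seq w <- graded_pairs cons block_candidates
                     (fun m => words_upto f' (n - m)) (iota 1 (minn d n)) | good d w]
  else [::].

Definition words n := words_upto n.+1 n.

Lemma words_uptoE f n : n < f -> words_upto f n = words n.
Proof.
rewrite /words; have [k] := ubnP n.
elim: k n f => // k IHk n [|f] //= nk nf; case: ifP => // n0.
congr filter; apply: eq_graded_pairs => // m; rewrite mem_iota => mr.
by rewrite (IHk _ f) ?(IHk _ n) //; lia.
Qed.

(** A block followed by a good word; such a word need not be good. *)
Definition next_words n :=
  graded_pairs cons block_candidates (fun m => words (n - m)) (iota 1 (minn d n)).

Lemma wordsE n : 0 < n -> words n = [seq w <- next_words n | good d w].
Proof.
case: n => // n _; have -> : words n.+1 = [seq w <- graded_pairs cons block_candidates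
    (fun m => words_upto n.+1 (n.+1 - m)) (iota 1 (minn d n.+1)) | good d w] by [].
congr filter; apply: eq_graded_pairs => // m; rewrite mem_iota => mr.
by apply: words_uptoE; lia.
Qed.

Lemma mem_candidates s t m : ((s, t) \in block_candidates m) = (leaves t == m).
Proof.
apply/allpairsP/eqP => [[[s' t'] [_ ]]|tm] /=.
  by rewrite mem_trees => /eqP tm [_ ->].
by exists (s, t); rewrite mem_trees tm eqxx; case: (s).
Qed.

Lemma candidates_uniq m : uniq (block_candidates m).
Proof. by apply: allpairs_uniq; rewrite ?trees_uniq // => -[? ?] [? ?] _ _ [-> ->]. Qed.

Lemma mem_words w n : (w \in words n) = good_word d n w.
Proof.
rewrite /good_word; elim: w n => [|[s t] w IHw] n.
  case: n => [|n] //; rewrite wordsE // mem_filter /=.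
  by apply/negP=> /graded_pairsP[i [x [y [_ _ _]]]].
have t_gt0 := leaves_gt0 t.
case: n => [|n].
  by rewrite /width /= addn_eq0 (gtn_eqF t_gt0) andbF.
rewrite wordsE // mem_filter; have [gsw|//] := boolP (good d _).
have [td gw] : leaves t <= d /\ good d w by case/and3P: gsw.
apply/graded_pairsP/idP => [[m [[s' t'] [w' [mr tm w'm]]]]|/=].
  case=> _ Et Ew; move: tm w'm mr; rewrite -Et -Ew mem_candidates IHw gw mem_iota.
  by rewrite /width /=; lia.
rewrite /width /= => /eqP wn; exists (leaves t), (s, t), w.
by rewrite mem_candidates IHw gw mem_iota /width; split=> //; lia.
Qed.

Lemma next_words_uniq n : (forall m, m < n -> uniq (words m)) -> uniq (next_words n).
Proof.
move=> Uw; apply: (@graded_pairs_uniq _ _ _ _ _ _ (fun u => leaves u.2)).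
- exact: iota_uniq.
- by move=> m _; apply: candidates_uniq.
- by move=> m; rewrite mem_iota => mr; apply: Uw; lia.
- by move=> m [s t] _; rewrite mem_candidates => /eqP.
by move=> m m' u u' w w' _ _ _ _ [-> ->].
Qed.

Lemma words_uniq n : uniq (words n).
Proof.
elim/ltn_ind: n => -[|n] IHn //.
by rewrite wordsE // filter_uniq // next_words_uniq.
Qed.

(** The two blocks obtained by cutting a tree at its root, with the letters
false and true: this is how the forbidden pairs of adjacent blocks arise, and
the total length is kept. *)
Definition split_root (t : tree) (w : seq block) : seq block :=
  if t is Node l r then [:: (false, l), (true, r) & w] else [::].

(** Lengths start at 2 because a forbidden pair has at least two leaves, that is,
comes from a tree which is not a leaf. *)
Definition close_words n :=
  graded_pairs split_root trees (fun m => words (n - m)) (iota 2 (minn d n).-1).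

(** Since the word following the first block is good, only the first pair of
blocks can be forbidden; once this pair is removed the rest is unconstrained,
because its second letter is true. *)
Lemma close_wordsP n :
  perm_eq [seq w <- next_words n | ~~ good d w] (close_words n).
Proof.
apply: uniq_perm.
- by rewrite filter_uniq // next_words_uniq // => m _; apply: words_uniq.
- apply: (@graded_pairs_uniq _ _ _ _ _ _ leaves).
  + exact: iota_uniq.
  + by move=> m _; apply: trees_uniq.
  + by move=> m _; apply: words_uniq.
  + by move=> m t _; rewrite mem_trees => /eqP.
  move=> m m' t t' w w'; rewrite !mem_iota !mem_trees => mr m'r tm t'm.
  case: t t' tm t'm => [|l r] [|l' r'] /= tm t'm; try lia.
  by case=> -> -> ->.
move=> w; rewrite mem_filter; apply/andP/graded_pairsP.
  case=> ngw /graded_pairsP[m [[s t] [w' []]]].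
  rewrite mem_iota mem_candidates mem_words => mr /eqP tm /andP[gw' /eqP w'n] Ew.
  move: ngw; rewrite Ew /= gw' andbT (_ : leaves t <= d) /=; last by lia.
  case: w' gw' w'n Ew => // -[s' t'] w' gsw' w'n Ew.
  have gw' : good d w' by case/and3P: gsw'.
  rewrite /far negb_imply /= -leqNgt => /andP[/andP[/negPf sF s'T] ttd].
  have := leaves_gt0 t; have := leaves_gt0 t' => t'_gt0 t_gt0.
  exists (leaves t + leaves t'), (Node t t'), w'.
  rewrite mem_iota mem_trees mem_words /good_word gw' sF s'T /=.
  by move: w'n; rewrite /width /=; split=> //; lia.
case=> m [[|l r] [w' []]]; rewrite mem_iota mem_trees mem_words /=; first by lia.
move=> mr /eqP lrm /andP[gw' /eqP w'n] ->.
have := leaves_gt0 l; have := leaves_gt0 r => r_gt0 l_gt0.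
have lrd : leaves l + leaves r <= d by lia.
split; first by rewrite /= /far /= ltnNge lrd andbF.
apply/graded_pairsP; exists (leaves l), (false, l), ((true, r) :: w').
rewrite mem_iota mem_candidates mem_words /good_word /= gw' andbT /width /=.
split=> //; try lia.
have -> : leaves r <= d by lia.
by case: w' gw' w'n => [|v w'] _; rewrite /width /=; lia.
Qed.

Lemma size_candidates m : size (block_candidates m) = 2 * size (trees m).
Proof. exact: size_allpairs. Qed.

(** Of the two copies of the trees with m leaves, one per letter, the forbidden
pairs cancel one copy for every m >= 2; a single leaf keeps both. *)
Lemma size_words n : 0 < d -> 0 < n ->
  size (words n) = size (words n.-1) +
    \sum_(m <- iota 1 (minn d n)) size (trees m) * size (words (n - m)).
Proof.
move=> d_gt0 n_gt0.
have dn : minn d n = (minn d n).-1.+1 by lia.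
have := count_predC (good d) (next_words n).
rewrite -!size_filter -wordsE // (perm_size (close_wordsP n)) !size_graded_pairs.
under [X in _ = X -> _]eq_bigr do rewrite size_candidates -mulnA.
rewrite -big_distrr /= [in iota 1 _]dn /= !big_cons subn1.
rewrite [size (trees 1)]/= mul1n.
by rewrite mul2n -addnn addnA => /addIn ->; rewrite addnC.
Qed.

End Words.

(** * Catalan numbers *)

Local Open Scope ring_scope.

Lemma catalan0 : catalan 0 = 1.
Proof. by rewrite /catalan muln0 bin0 invr1 mulr1. Qed.

Lemma catalan_step k : (k + 2)%:R * catalan k.+1 = (4 * k + 2)%:R * catalan k.
Proof.
have binS : (k.+1 * 'C((2 * k.+1)%N, k.+1) = 2 * (2 * k + 1) * 'C((2 * k)%N, k))%N.
  have -> : (2 * k.+1)%N = (2 * k).+2 by lia.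
  have := mul_bin_diag (2 * k).+2 k.
  have := mul_bin_down (2 * k).+2 k; have := mul_bin_down (2 * k).+1 k.
  have -> : ((2 * k).+2 - k = k.+2)%N by lia.
  have -> : ((2 * k).+1 - k = k.+1)%N by lia.
  rewrite /= => e1 e2 e3.
  have := mul_bin_diag (2 * k).+1 k; rewrite /=.
  nia.
have := congr1 (fun x => x%:R : rat) binS.
rewrite /catalan !natrM => e.
have k1 : (k.+1)%:R != 0 :> rat by rewrite pnatr_eq0.
have k2 : (k.+2)%:R != 0 :> rat by rewrite pnatr_eq0.
apply: (mulfI k1); rewrite addn2 mulVKf // e !mulrA [k.+1%:R * _]mulrC mulfK //.
by congr (_ * _); rewrite -natrM; congr _%:R; lia.
Qed.

(** Weighting the convolution s_m = sum c_i c_(m-i) by i multiplies it by m / 2,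
by the symmetry i <-> m - i.  Hence weighting s_(n+1) by i + 1 gives
(n + 3) / 2 s_(n+1); but (i + 2) c_(i+1) = (4 i + 2) c_i turns the same sum into
c_(n+1) + (2 n + 2) s_n.  With s_n = c_(n+1) this is (2 n + 3) c_(n+1), so that
s_(n+1) satisfies the recurrence of c_(n+2). *)
Lemma convolution_of_step (F : numFieldType) (c : nat -> F) : c 0%N = 1 ->
  (forall k, (k + 2)%:R * c k.+1 = (4 * k + 2)%:R * c k) ->
  forall n, \sum_(i < n.+1) c i * c (n - i)%N = c n.+1.
Proof.
move=> c0 c_step n.
pose s n : F := \sum_(i < n.+1) c i * c (n - i)%N.
have sym m : (\sum_(i < m.+1) i%:R * (c i * c (m - i)%N)) *+ 2 = m%:R * s m.
  rewrite mulr2n [X in _ + X](reindex_inj rev_ord_inj) /=.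
  rewrite /s mulr_sumr -big_split /=; apply: eq_bigr => i _.
  have im : (i <= m)%N by rewrite -ltnS.
  rewrite subSS (subKn im) [c (m - i)%N * _]mulrC -mulrDl.
  by rewrite -natrD subnKC.
rewrite -/(s n); elim: n => [|n IHn].
  rewrite /s big_ord1 c0 mul1r.
  by apply: (@mulfI _ 2%:R); rewrite ?pnatr_eq0 // (c_step 0) c0.
have n3 : (n.+1 + 2)%:R != 0 :> F by rewrite pnatr_eq0 addn2.
apply: (mulfI n3); rewrite c_step.
have : \sum_(i < n.+2) (i%:R + 1) * (c i * c (n.+1 - i)%N) =
    c n.+1 + \sum_(i < n.+1) (4%:R * i%:R + 2%:R) * (c i * c (n - i)%N).
  rewrite big_ord_recl /= add0r mul1r c0 mul1r; congr (_ + _).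
  apply: eq_bigr => i _; rewrite /bump /= add1n subSS !mulrA; congr (_ * _).
  rewrite -[4%:R * _]natrM -[_ + 2%:R]natrD -c_step.
  by rewrite -[i.+1]addn1 !natrD; ring.
under eq_bigr do rewrite mulrDl mul1r.
rewrite big_split /= -/(s n.+1).
under [X in _ = _ + X -> _]eq_bigr do rewrite mulrDl -mulrA.
rewrite big_split -!mulr_sumr /= -/(s n).
have := sym n; have := sym n.+1; rewrite IHn !mulr2n.
set T := \sum_(i < n.+1) _; set T' := \sum_(i < n.+2) _.
rewrite -[n.+1]addn1 !(natrD, natrM) => e' e e2.
have -> : (n%:R + 1 + 2%:R) * s (n + 1)%N = 2%:R * (T' + s (n + 1)%N).
  by transitivity (T' + T' + 2%:R * s (n + 1)%N); [rewrite e'|]; ring.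
rewrite e2.
transitivity (2%:R * c (n + 1)%N + 4%:R * (T + T) + 4%:R * c (n + 1)%N); first by ring.
by rewrite e; ring.
Qed.

Lemma catalan_convolution n :
  \sum_(i < n.+1) catalan i * catalan (n - i)%N = catalan n.+1.
Proof. exact: convolution_of_step catalan0 catalan_step n. Qed.

Lemma size_trees m : (size (trees m.+1))%:R = catalan m.
Proof.
elim/ltn_ind: m => -[|m] IHm; first by rewrite catalan0.
rewrite treesE // size_graded_pairs natr_sum -catalan_convolution.
rewrite -[m.+2.-1]/(m.+1) (iotaDl 1 0) big_map -/(index_iota 0 m.+1) big_mkord.
apply: eq_bigr => i _; have im : (i <= m)%N by rewrite -ltnS.
rewrite natrM add1n subSS (subSn im); congr (_ * _); first exact: IHm.
by apply: IHm; rewrite ltnS leq_subr.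
Qed.

(** * The generating function *)

Lemma nb_diagramsE d n : (0 < d)%N -> nb_diagrams d n = size (words d n).
Proof.
move=> d_gt0; rewrite /nb_diagrams; case: eqP => [->//|/eqP n_neq0].
rewrite -(size_map (diagram n)).
have Uw : uniq [seq diagram n w | w <- words d n].
  rewrite map_inj_in_uniq ?words_uniq // => w w'; rewrite !mem_words.
  exact: diagram_inj.
rewrite -(card_uniqP Uw); apply: eq_card => A; apply/idP/mapP => [/diagram_onto|].
  by case=> // w gw ->; exists w; rewrite ?mem_words.
by case=> w; rewrite mem_words => gw ->; apply: diagram_admissible.
Qed.

(** As C_0 = 1, one of the two copies of the monomial x joins the sum as its
term of index 0. *)
Lemma coef_denominator d n : (0 < d)%N ->
  fps_of_poly (1 - 2%:R *: 'X - \sum_(1 <= k < d) catalan k *: 'X^(k + 1)) n.+1 =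
  - ((n == 0%N)%:R + (if (n < d)%N then catalan n else 0)).
Proof.
move=> d_gt0; rewrite /fps_of_poly !coefB coefZ coef1 coefX coef_sum.
have -> : \sum_(1 <= k < d) (catalan k *: 'X^(k + 1))`_n.+1 =
    \sum_(1 <= k < d | k == n) catalan k.
  rewrite [RHS]big_mkcond; apply: eq_bigr => k _.
  rewrite coefZ coefXn addn1 eqSS eq_sym.
  by case: eqP => _; rewrite (mulr1, mulr0).
have [nd|dn] := ltnP n d; last first.
  rewrite big_nat_cond big_pred0; last by move=> k; lia.
  case: n dn => [|n] dn; first by lia.
  by rewrite mulr0 !subr0 oppr0.
case: n nd => [|n] nd.
  rewrite big_nat_cond big_pred0; last by move=> k; lia.
  by rewrite catalan0 sub0r subr0 mulr1.
by rewrite big_nat1_eq nd mulr0 subr0 !add0r.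
Qed.

Lemma coef0_denominator d :
  fps_of_poly (1 - 2%:R *: 'X - \sum_(1 <= k < d) catalan k *: 'X^(k + 1)) 0 = 1.
Proof.
rewrite /fps_of_poly !coefB coefZ coef1 coefX coef_sum big1 ?mulr0 ?subr0 // => k _.
by rewrite coefZ coefXn addn1 mulr0.
Qed.

Lemma nb_diagrams_rec d n : (0 < d)%N ->
  (nb_diagrams d n.+1)%:R = (nb_diagrams d n)%:R +
    \sum_(k < n.+1)
       (if (k < d)%N then catalan k else 0) * (nb_diagrams d (n - k))%:R :> rat.
Proof.
move=> d_gt0; rewrite !nb_diagramsE // size_words // natrD; congr (_ + _).
rewrite natr_sum (iotaDl 1 0) big_map.
rewrite (eq_bigr (fun k => catalan k * (nb_diagrams d (n - k))%:R)); last first.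
  by move=> k _; rewrite natrM add1n subSS size_trees nb_diagramsE.
rewrite -(big_mkord xpredT (fun k => (if (k < d)%N then catalan k else 0) *
   (nb_diagrams d (n - k))%:R)).
rewrite (big_cat_nat (n := minn d n.+1)) ?geq_minr //=.
rewrite [X in _ = _ + X]big_nat_cond [X in _ = _ + X]big1 ?addr0; last first.
  by move=> k kP; rewrite ifF ?mul0r //; lia.
rewrite /index_iota subn0; apply: eq_big_seq => k; rewrite mem_iota => kP.
by rewrite ifT //; lia.
Qed.

Theorem corollary3p26 (d : nat) (hd : (1 <= d)%N) :
  diagram_series d =1
  fps_inv (fps_of_poly
    (1 - 2%:R *: 'X - \sum_(1 <= k < d) catalan k *: 'X^(k + 1))).
Proof.
apply: fps_inv_unique => [|n]; first by rewrite coef0_denominator oner_eq0.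
rewrite /fps_mul big_ord_recl coef0_denominator mul1r subn0 /diagram_series.
case: n => [|n]; first by rewrite big_ord0 addr0.
rewrite nb_diagrams_rec // [X in _ + X = _](eq_bigr (fun k : 'I_n.+1 =>
  - ((k == 0%N :> nat)%:R * (nb_diagrams d (n - k))%:R +
     (if (k < d)%N then catalan k else 0) * (nb_diagrams d (n - k))%:R))).
  rewrite sumrN big_split /=; set rest := \sum_(i < n.+1) (if _ then _ else _) * _.
  rewrite (_ : \sum_(i < n.+1) (i == 0%N :> nat)%:R * _ = (nb_diagrams d n)%:R).
    exact: subrr.
  by rewrite big_ord_recl mul1r subn0 big1 ?addr0 // => i _; rewrite mul0r.
by move=> k _; rewrite lift0 subSS coef_denominator // mulNr mulrDl.
Qed.
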